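(* For every $n\ge 2$ with $n\neq 3$, $\gamma_{OLD}(M(P_n))=\gamma_{OLD}(P_n)+2$. For every $n\ge 3$ with $n\neq 4$, $\gamma_{OLD}(C_n)+1\le\gamma_{OLD}(M(C_n))\le\gamma_{OLD}(C_n)+2$.
   Context: All graphs are finite, simple and connected. For a graph $G=(V,E)$ and $x\in V$, $N(x)$ is the open neighbourhood. A set $C\subseteq V$ is an open locating-dominating set ($OLD$-set) if $N(x)\cap C\neq\emptyset$ for all $x\in V$ and $N(x)\cap C\ne N(y)\cap C$ for all distinct $x,y\in V$; $\gamma_{OLD}(G)$ is the minimum size of an $OLD$-set. $P_n$ is the path and $C_n$ the cycle on $n$ vertices. The Mycielski graph $M(G)$ of $G$ with $V=\{v_1,\dots,v_n\}$ is obtained from $G$ by adding, for each $i$, a new vertex $u_i$ adjacent to every vertex of $N_G(v_i)$, and then adding one further vertex $u$ adjacent to all of $u_1,\dots,u_n$ (and to nothing else). *)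

(* Defs.v *)
From mathcomp Require Import all_boot.
Set Implicit Arguments.
Unset Strict Implicit.
Unset Printing Implicit Defensive.

Record sgraph := SGraph {
  vertex :> finType;
  adj : rel vertex;
  adj_sym : symmetric adj;
  adj_irrefl : irreflexive adj }.

Definition nbhd (G : sgraph) (x : G) : {set G} := [set y | adj x y].

Definition OLD_set (G : sgraph) (C : {set G}) : bool :=
  [forall x : G, nbhd x :&: C != set0] &&
  [forall x : G, forall y : G, (x != y) ==> (nbhd x :&: C != nbhd y :&: C)].

Definition has_OLD_set (G : sgraph) : Prop := exists C : {set G}, OLD_set C.

(* Meaningful only under [has_OLD_set G]: a superset of an OLD-set is an
   OLD-set, so [setT] is then a legitimate starting point for [arg min]. Without
   any OLD-set the value is the junk #|G|. *)
Definition gamma_OLD (G : sgraph) : nat :=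
  #|[arg min_(C < [set: G] | OLD_set C) #|C|]|.

Lemma OLD_setP (G : sgraph) (C : {set G}) :
  reflect ((forall x : G, nbhd x :&: C <> set0) /\
           (forall x y : G, x <> y -> nbhd x :&: C <> nbhd y :&: C))
          (OLD_set C).
Proof.
apply: (iffP andP) => [] [h1 h2]; split.
- by move=> x; apply/eqP/(forallP h1).
- by move=> x y /eqP xy; apply/eqP/(implyP (forallP (forallP h2 x) y)).
- by apply/forallP => x; apply/eqP/h1.
- by apply/forallP => x; apply/forallP => y; apply/implyP => /eqP xy;
    apply/eqP/h2.
Qed.

Lemma OLD_setS (G : sgraph) (C D : {set G}) :
  C \subset D -> OLD_set C -> OLD_set D.
Proof.
move=> sCD /OLD_setP [dom sep]; apply/OLD_setP.
have eqI (x : G) : nbhd x :&: C = nbhd x :&: D :&: C.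
  by rewrite -setIA (setIidPr sCD).
split=> [x xD0 | x y xy xyD].
- by apply: (dom x); rewrite eqI xD0 set0I.
- by apply: (sep x y xy); rewrite eqI xyD -eqI.
Qed.

Lemma gamma_OLDP (G : sgraph) : has_OLD_set G ->
  (exists2 C : {set G}, OLD_set C & #|C| = gamma_OLD G) /\
  (forall C : {set G}, OLD_set C -> gamma_OLD G <= #|C|).
Proof.
case=> C0 /(OLD_setS (subsetT C0)) oT; rewrite /gamma_OLD.
by case: arg_minnP => // C oC minC; split=> //; exists C.
Qed.

Section Path.
Variable n : nat.
Definition path_adj : rel 'I_n := fun i j => (j == i.+1 :> nat) || (i == j.+1 :> nat).
Lemma path_adj_sym : symmetric path_adj.
Proof. by move=> i j; rewrite /path_adj orbC. Qed.
Lemma path_adj_irrefl : irreflexive path_adj.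
Proof. by move=> i; rewrite /path_adj orbb (ltn_eqF (ltnSn i)). Qed.
Definition path_graph : sgraph := SGraph path_adj_sym path_adj_irrefl.
End Path.

(* [ordS i] has value [i.+1 %% n]; the guard [i != j] only matters for n = 1. *)
Section Cycle.
Variable n : nat.
Definition cycle_adj : rel 'I_n :=
  fun i j => (i != j) && ((j == ordS i) || (i == ordS j)).
Lemma cycle_adj_sym : symmetric cycle_adj.
Proof. by move=> i j; rewrite /cycle_adj eq_sym orbC. Qed.
Lemma cycle_adj_irrefl : irreflexive cycle_adj.
Proof. by move=> i; rewrite /cycle_adj eqxx. Qed.
Definition cycle_graph : sgraph := SGraph cycle_adj_sym cycle_adj_irrefl.
End Cycle.

(* [inl v] is the original vertex v, [inr (Some v)] is the new vertex u_v
   attached to N(v), and [inr None] is the apex u. *)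
Section Mycielski.
Variable G : sgraph.
Definition mycielski_adj : rel (G + option G)%type := fun a b =>
  match a, b with
  | inl x, inl y => adj x y
  | inl x, inr (Some y) => adj y x
  | inr (Some x), inl y => adj x y
  | inr (Some _), inr None => true
  | inr None, inr (Some _) => true
  | _, _ => false
  end.
Lemma mycielski_adj_sym : symmetric mycielski_adj.
Proof. by case=> [x|[x|]] [y|[y|]] //=; apply: adj_sym. Qed.
Lemma mycielski_adj_irrefl : irreflexive mycielski_adj.
Proof. by case=> [x|[x|]] //=; apply: adj_irrefl. Qed.
Definition mycielski : sgraph := SGraph mycielski_adj_sym mycielski_adj_irrefl.
End Mycielski.

(* Main.v *)
Require Import Defs.
From mathcomp Require Import all_boot zify.

(** In fact [gamma_OLD (M G) = gamma_OLD G + 2] for every nonempty graph [G]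
    that has an OLD-set.  Adding the apex and one [u_v] to an OLD-set of [G]
    gives an OLD-set of [M G].  Conversely let [D] be an OLD-set of [M G], with
    trace [C] on [G].
    - If the apex is in [D], the vertices [u_i] force [C] to separate [G], so
      [C] misses the neighbourhood of at most one vertex [x].  Domination of the
      apex gives some [u_j] in [D]; when [x] exists, separating [x] from the
      apex requires two of them, which pays for one neighbour of [x] added
      to [C].
    - Otherwise [C] is an OLD-set of [G], and separating [v_i] from [u_i] makes
      the indices of the [u_j] in [D] a total dominating set of [G], which has
      at least two elements. *)

Set Implicit Arguments.
Unset Strict Implicit.
Unset Printing Implicit Defensive.

(** Separation is put contrapositively: agreement on [C] yields an equality of vertices, which is
    absurd between vertices of different kinds in a Mycielski graph. *)
Lemma OLD_set_adjP (G : sgraph) (C : {set G}) :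
  reflect ((forall x : G, exists2 z, z \in C & adj x z) /\
           (forall x y : G, {in C, adj x =1 adj y} -> x = y))
          (OLD_set C).
Proof.
apply: (iffP (OLD_setP C)) => [] [dom sep]; split.
- move=> x; have /eqP/set0Pn[z] := dom x.
  by rewrite !inE => /andP[xz zC]; exists z.
- move=> x y xy; have [//|/eqP /sep []] := eqVneq x y.
  by apply/setP => z; rewrite !inE; case zC: (z \in C); rewrite ?andbF ?xy.
- move=> x; have [z zC xz] := dom x => /setP/(_ z).
  by rewrite !inE xz zC.
- move=> x y xy /setP eqN; apply: xy; apply: sep => z zC.
  by have := eqN z; rewrite !inE zC !andbT.
Qed.

Lemma card_mycielski (G : sgraph) (D : {set mycielski G}) :
  #|D| = #|[set v : G | inl v \in D]| + #|[set v : G | inr (Some v) \in D]|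
         + (inr None \in D).
Proof.
rewrite -!sum1_card big_sumType /= -addnA; congr addn.
  by apply: eq_bigl => v; rewrite inE.
rewrite big_mkcond (bigD1 None) //= addnC; congr addn.
rewrite (reindex_omap Some id) /=; last by case.
rewrite [RHS]big_mkcond /=; under eq_bigl do rewrite eqxx.
by apply: eq_bigr => v _; rewrite inE.
Qed.

Lemma OLD_set_to_mycielski (G : sgraph) (v : G) (C : {set G}) : OLD_set C ->
  exists2 D : {set mycielski G}, OLD_set D & #|D| = #|C| + 2.
Proof.
move=> /OLD_set_adjP [dom sep].
(* The new vertex over [v] serves to dominate the apex; the apex, being in [D], separates new
   vertices from all others. *)
pose D : {set mycielski G} := [set a | match a with
  | inl x => x \in C | inr (Some x) => x == v | inr None => true end].
exists D; last first.
  have -> : #|C| = #|[set x : G | inl x \in D]|.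
    by apply: eq_card => x; rewrite !inE.
  rewrite card_mycielski inE -addnA; congr addn; rewrite addn1; congr _.+1.
  by rewrite -(cards1 v); apply: eq_card => x; rewrite !inE.
have vD : inr (Some v) \in D by rewrite inE.
have uD : inr None \in D by rewrite inE.
have CD x : x \in C -> inl x \in D by rewrite inE.
apply/OLD_set_adjP; split.
  case=> [x|[x|]]; last by exists (inr (Some v)).
    by have [z /CD zD xz] := dom x; exists (inl z).
  by have [z /CD zD xz] := dom x; exists (inl z).
have old_new (x y : G) : ~ {in D, adj (inl x : mycielski G) =1
    adj (inr (Some y) : mycielski G)}.
  by move/(_ _ uD).
have old_apex (x : G) : ~ {in D, adj (inl x : mycielski G) =1
    adj (inr None : mycielski G)}.
  by have [z /CD zD xz] := dom x => /(_ _ zD) /=; rewrite xz.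
have new_apex (x : G) : ~ {in D, adj (inr (Some x) : mycielski G) =1
    adj (inr None : mycielski G)}.
  by move/(_ _ uD).
have symD (a b : mycielski G) : {in D, adj a =1 adj b} -> {in D, adj b =1 adj a}.
  by move=> ab z zD; rewrite ab.
move=> [x|[x|]] [y|[y|]] // ab;
  try (by case: (old_new _ _ ab)); try (by case: (old_new _ _ (symD _ _ ab)));
  try (by case: (old_apex _ ab)); try (by case: (old_apex _ (symD _ _ ab)));
  try (by case: (new_apex _ ab)); try (by case: (new_apex _ (symD _ _ ab))).
  by congr inl; apply: sep => z /CD /ab.
by congr (inr (Some _)); apply: sep => z /CD /ab.
Qed.

Lemma OLD_set_of_mycielski (G : sgraph) (D : {set mycielski G}) : OLD_set D ->
  exists2 C : {set G}, OLD_set C & #|C| + 2 <= #|D|.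
Proof.
move=> /OLD_set_adjP [dom sep].
set C := [set v : G | inl v \in D]; set U := [set v : G | inr (Some v) \in D].
have cardD : #|D| = #|C| + #|U| + (inr None \in D) := card_mycielski D.
(* All new vertices see the apex and none sees another, so only original vertices in [D] can tell
   two of them apart. *)
have sepC (x y : G) : {in C, adj x =1 adj y} -> x = y.
  move=> xy; suff [] : inr (Some x) = inr (Some y) :> mycielski G by [].
  by apply: sep => -[z|[z|]] zD //=; apply: xy; rewrite inE.
have [j0 j0U] : exists j, j \in U.
  by have [[z|[z|]] zD //= _] := dom (inr None); exists z; rewrite inE.
case uD: (inr None \in D) in cardD; last first.
  exists C.
    apply/OLD_set_adjP; split=> // x.
    have [[z|[z|]] zD //= xz] := dom (inr (Some x)); last by rewrite zD in uD.
    by exists z; rewrite ?inE.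
  have Udom x : exists2 j, j \in U & adj x j.
    case: (pickP [pred j | (j \in U) && adj x j]) => [j /andP[jU xj]|none].
      by exists j.
    suff : inl x = inr (Some x) :> mycielski G by [].
    apply: sep => -[z|[z|]] zD //=; last by rewrite zD in uD.
    by have := none z; rewrite /= inE zD /= adj_sym.
  (* No vertex is adjacent to itself, so dominating [j0] takes a second index. *)
  have [j1 j1U j01] := Udom j0.
  rewrite cardD addn0 leq_add2l (cardD1 j0) j0U (cardD1 j1) !inE.
  rewrite inE in j1U; rewrite j1U andbT.
  by case: eqP j01 => // ->; rewrite adj_irrefl.
have U_gt0 : 0 < #|U| by rewrite (cardD1 j0) j0U.
case: (pickP [pred x : G | [forall z in C, ~~ adj x z]]) => [x|domC]; last first.
  exists C; last by rewrite cardD; lia.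
  apply/OLD_set_adjP; split=> // x.
  have /negbT := domC x; rewrite /= negb_forall_in => /exists_inP[z zC].
  by rewrite negbK; exists z.
move=> /forall_inP /= xC0.
have [[z|[j|]] jD //= jx] := dom (inl x).
  by have := xC0 z; rewrite inE jD jx => /(_ isT).
have jU : j \in U by rewrite inE.
exists (j |: C).
  apply/OLD_set_adjP; split=> [y|y z yz]; last first.
    by apply: sepC => w wC; apply: yz; rewrite !inE in wC *; rewrite wC orbT.
  case: (pickP [pred z | (z \in C) && adj y z]) => [z /andP[zC yz]|none].
    by exists z; rewrite // !inE; rewrite inE in zC; rewrite zC orbT.
  (* Like [x], the vertex [y] sees nothing of [C], so [sepC] identifies them. *)
  suff -> : y = x by exists j; [rewrite !inE eqxx | rewrite adj_sym].
  apply: sepC => z zC; rewrite (negbTE (xC0 z zC)).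
  by have := none z; rewrite /= zC.
have [k kU jk] : exists2 k, k \in U & k != j.
  case: (pickP [pred k | (k \in U) && (k != j)]) => [k /andP[]|none].
    by exists k.
  (* If [j] were the only index in [U], then [inl x] and the apex would both have [inr (Some j)] as
     sole neighbour in [D]. *)
  suff : inl x = inr None :> mycielski G by [].
  apply: sep => -[z|[z|]] zD //=.
    by apply/negbTE/xC0; rewrite inE.
  have := none z; rewrite /= inE zD /= => /negbT; rewrite negbK => /eqP->.
  by rewrite jx.
have : 1 < #|U| by rewrite (cardD1 j) jU (cardD1 k) inE /= jk kU.
have := cardsU1 j C; rewrite cardD; case: (_ \notin _) => /=; lia.
Qed.

(** The vertex [v] excludes the empty graph, whose Mycielski graph is an isolated apex and has no
    OLD-set. *)
Theorem gamma_OLD_mycielski (G : sgraph) (v : G) : has_OLD_set G ->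
  has_OLD_set (mycielski G) /\
  gamma_OLD (mycielski G) = gamma_OLD G + 2.
Proof.
move=> oldG; have [[C oldC cardC] minC] := gamma_OLDP oldG.
have [D oldD cardD] := OLD_set_to_mycielski v oldC.
have oldM : has_OLD_set (mycielski G) by exists D.
have [[E oldE cardE] minE] := gamma_OLDP oldM.
split=> //; apply/eqP; rewrite eqn_leq -{1}cardC -cardD minE //=.
have [F oldF] := OLD_set_of_mycielski oldE; rewrite cardE.
by apply: leq_trans; rewrite leq_add2r minC.
Qed.

Lemma has_OLD_set_twin_free (G : sgraph) :
  (forall x : G, exists z, adj x z) -> (forall x y : G, adj x =1 adj y -> x = y) ->
  has_OLD_set G.
Proof.
move=> dom sep; exists setT; apply/OLD_set_adjP; split=> [x|x y xy].
  by have [z xz] := dom x; exists z.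
by apply: sep => z; apply: xy.
Qed.

(** If [x < y] had equal neighbourhoods, [y] would be the last vertex, since [y.+1] is not adjacent
    to [x]; likewise [x] would be 0. Then [y.-1] is adjacent to 0, so [y] is 2 and [n] is 3. *)
Lemma has_OLD_set_path n : 2 <= n -> n <> 3 -> has_OLD_set (path_graph n).
Proof.
move=> n_ge2 n_neq3; apply: has_OLD_set_twin_free => [x|x y].
  have x_lt := ltn_ord x; have [xS|xS] := ltnP x.+1 n.
    by exists (Ordinal xS); rewrite /= /path_adj /= eqxx.
  have xP : x.-1 < n by lia.
  by exists (Ordinal xP); rewrite /= /path_adj /=; lia.
wlog xy : x y / x < y => [wlogxy eqN|eqN].
  have [xy|yx|/val_inj //] := ltngtP x y; first exact: wlogxy.
  by apply/esym/wlogxy.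
have x_lt := ltn_ord x; have y_lt := ltn_ord y.
have y_last : y.+1 = n.
  have [yS|] := ltnP y.+1 n; last lia.
  by have := eqN (Ordinal yS); rewrite /= /path_adj /=; lia.
(* For [x] equal to 0 the test vertex is [x] itself, which gives that [y] is not 1. *)
have xP : x.-1 < n by lia.
have := eqN (Ordinal xP); rewrite /= /path_adj /= => eqxP.
have yP : y.-1 < n by lia.
have := eqN (Ordinal yP); rewrite /= /path_adj /= => eqyP.
lia.
Qed.

Lemma val_ordS n (i : 'I_n) : ordS i = (if i.+1 == n then 0 else i.+1) :> nat.
Proof.
rewrite /=; case: eqP => [->|]; first by rewrite modnn.
by have := ltn_ord i => *; rewrite modn_small //; lia.
Qed.

(** Distinct vertices with equal neighbourhoods would each be two steps after the other, so [n]
    would divide 4. *)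
Lemma has_OLD_set_cycle n : 3 <= n -> n <> 4 -> has_OLD_set (cycle_graph n).
Proof.
move=> n_ge3 n_neq4.
have adjS (x : cycle_graph n) : adj x (ordS x).
  rewrite /= /cycle_adj eqxx andbT -val_eqE.
  by have := val_ordS x => /= ->; have := ltn_ord x; case: ifP; lia.
apply: has_OLD_set_twin_free => [x|x y eqN]; first by exists (ordS x).
have neighS (a b : 'I_n) : cycle_adj a (ordS b) -> a = b \/ a = ordS (ordS b).
  by case/andP=> _ /orP[/eqP/ordS_inj->|/eqP->]; [left | right].
have [//|xSSy] : x = y \/ x = ordS (ordS y).
  by apply: neighS; have := adjS y; rewrite -eqN.
have [//|ySSx] : y = x \/ y = ordS (ordS x).
  by apply: neighS; have := adjS x; rewrite eqN.
have := congr1 val xSSy; have := congr1 val ySSx; rewrite -![val _]/(nat_of_ord _).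
rewrite !val_ordS; have := ltn_ord x; have := ltn_ord y.
by do !case: eqP; lia.
Qed.

Theorem theorem6 :
  (forall n : nat, 2 <= n -> n <> 3 ->
     [/\ has_OLD_set (path_graph n),
         has_OLD_set (mycielski (path_graph n)) &
         gamma_OLD (mycielski (path_graph n)) = gamma_OLD (path_graph n) + 2])
  /\
  (forall n : nat, 3 <= n -> n <> 4 ->
     [/\ has_OLD_set (cycle_graph n),
         has_OLD_set (mycielski (cycle_graph n)),
         gamma_OLD (cycle_graph n) + 1 <= gamma_OLD (mycielski (cycle_graph n)) &
         gamma_OLD (mycielski (cycle_graph n)) <= gamma_OLD (cycle_graph n) + 2]).
Proof.
split=> n n_ge n_neq.
  have old := has_OLD_set_path n_ge n_neq.
  have v : path_graph n by exists 0; apply: ltnW.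
  by have [] := gamma_OLD_mycielski v old.
have old := has_OLD_set_cycle n_ge n_neq.
have v : cycle_graph n by exists 0; apply: leq_trans n_ge.
have [oldM gammaM] := gamma_OLD_mycielski v old.
by rewrite gammaM leq_add2l.
Qed.
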